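(* Let $q$ be a prime power, let $r,t\ge2$ be integers, let $\alpha$ be a root of an irreducible polynomial of degree $t$ over $\mathbb{F}_q$, so that $\mathbb{F}_{q^t}=\mathbb{F}_q[\alpha]$, regarded inside $\mathbb{F}_{q^{rt}}$, and let $h\ge0$ be an integer. Then the $[th+(r-1)t+1,\ h+(r-1)t+1]_{q^{rt}/q}$ system \[\mathcal{U}=\left\{\begin{pmatrix} u\\ w\end{pmatrix}: u\in\mathbb{F}_q^{(r-1)t+1},\ w\in\mathbb{F}_{q^t}^{h}\right\}\le\mathbb{F}_{q^{rt}}^{h+(r-1)t+1},\] which has generator matrix $\begin{pmatrix} I_{(r-1)t+1} & 0 & 0 & \cdots & 0\\ 0 & I_h & \alpha I_h & \cdots & \alpha^{t-1}I_h\end{pmatrix}$, is rank-$((r-1)t+1)$-saturating. In particular, \[s_{q^{rt}/q}\big(h+(r-1)t+1,\ (r-1)t+1\big)\le th+(r-1)t+1.\]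
   Context: An $[n,k]_{q^m/q}$ system is an $n$-dimensional $\mathbb{F}_q$-subspace $\mathcal{U}\le\mathbb{F}_{q^m}^k$ with $\langle\mathcal{U}\rangle_{\mathbb{F}_{q^m}}=\mathbb{F}_{q^m}^k$; its linear set is $L_\mathcal{U}=\{\langle u\rangle_{\mathbb{F}_{q^m}}:u\in\mathcal{U}\setminus\{0\}\}\subseteq\mathrm{PG}(k-1,q^m)$. A point set is $r'$-saturating if every point of $\mathrm{PG}(k-1,q^m)$ lies in the span of some $r'+1$ of its points and $r'$ is minimal with this property; $\mathcal{U}$ is rank-$\rho$-saturating if $L_\mathcal{U}$ is $(\rho-1)$-saturating. $s_{q^m/q}(k,\rho)$ is the minimum $n$ such that an $[n,k]_{q^m/q}$ rank-$\rho$-saturating system exists. *)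

(* Defs.v *)
From HB Require Import structures.
From mathcomp Require Import all_boot all_order all_algebra all_fingroup all_field.

Set Implicit Arguments.
Unset Strict Implicit.
Unset Printing Implicit Defensive.

Import GRing.Theory.
Local Open Scope ring_scope.

(* Throughout, F = F_q and L = F_{q^m}. The space L^k occurs with two scalar  *)
(* fields: {ffun 'I_k -> L} carries the F-linear structure, in which systems  *)
(* live, and 'cV[L]_k the L-linear one; [colv] identifies the two.            *)
Section Systems.
Variables (F : finFieldType) (L : fieldExtType F).

Definition colv k (v : {ffun 'I_k -> L}) : 'cV[L]_k := \col_i v i.

(* The L-span of U is all of L^k iff L^k is the only L-subspace containing U. *)
Definition is_system (n k : nat) (U : {vspace {ffun 'I_k -> L}}) : Prop :=
  \dim U = n /\
  forall W : {vspace 'cV[L]_k},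
    (forall u, u \in U -> colv u \in W) -> W = fullv.

Definition generator_matrix k n (U : {vspace {ffun 'I_k -> L}})
    (G : 'M[L]_(k, n)) : Prop :=
  basis_of U [seq [ffun i => G i j] | j <- enum 'I_n].

(* Points of PG(k-1, L) are the one-dimensional L-subspaces of L^k. *)
Definition is_point k (P : {vspace 'cV[L]_k}) : Prop := \dim P = 1%N.

Definition linear_set k (U : {vspace {ffun 'I_k -> L}})
    (P : {vspace 'cV[L]_k}) : Prop :=
  exists u, [/\ u \in U, u != 0 & P = <[colv u]>%VS].

Definition spanned_by k (S : {vspace 'cV[L]_k} -> Prop) (m : nat) : Prop :=
  forall Q, is_point Q ->
    exists P : 'I_m -> {vspace 'cV[L]_k},
      [/\ injective P, forall i, S (P i) & (Q <= \sum_i P i)%VS].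

Definition saturating k (S : {vspace 'cV[L]_k} -> Prop) (r' : nat) : Prop :=
  spanned_by S r'.+1 /\ forall r'', spanned_by S r''.+1 -> (r' <= r'')%N.

Definition rank_saturating k (U : {vspace {ffun 'I_k -> L}})
    (rho : nat) : Prop :=
  (0 < rho)%N /\ saturating (linear_set U) rho.-1.

Definition exists_rank_saturating (k rho n : nat) : Prop :=
  exists U : {vspace {ffun 'I_k -> L}}, is_system n U /\ rank_saturating U rho.

(* s = s_{q^m/q}(k, rho) *)
Definition is_s (k rho s : nat) : Prop :=
  exists_rank_saturating k rho s /\
  forall n, exists_rank_saturating k rho n -> (s <= n)%N.

Definition coordv k (i : 'I_k) (v : {ffun 'I_k -> L}) : L := v i.

Fact coordv_is_linear k (i : 'I_k) : linear (coordv i).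
Proof. by move=> a u v; rewrite /coordv !ffunE. Qed.

HB.instance Definition _ k (i : 'I_k) :=
  GRing.isLinear.Build F {ffun 'I_k -> L} L *:%R (coordv i)
    (coordv_is_linear i).

(* F^rho x F[alpha]^h; membership is spelled out in [mem_sysU] below. *)
Definition sysU (rho h : nat) (alpha : L) :
    {vspace {ffun 'I_(rho + h) -> L}} :=
  ((\bigcap_(i < rho) linfun (coordv (lshift h i)) @^-1: 1) :&:
   (\bigcap_(j < h) linfun (coordv (rshift rho j)) @^-1: <<1; alpha>>))%VS.

Lemma mem_sysU rho h alpha (v : {ffun 'I_(rho + h) -> L}) :
  v \in sysU rho h alpha <->
  (forall i : 'I_rho, v (lshift h i) \in 1%VS) /\
  (forall j : 'I_h, v (rshift rho j) \in <<1; alpha>>%VS).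
Proof.
rewrite memv_cap; split=> [/andP[/subv_bigcapP Hu /subv_bigcapP Hw]|[Hu Hw]].
  split=> [i|j]; first by have:= Hu i isT; rewrite -memvE -memv_preim lfunE.
  by have:= Hw j isT; rewrite -memvE -memv_preim lfunE.
by apply/andP; split; apply/subv_bigcapP=> i _;
  rewrite -memvE -memv_preim lfunE /= ?Hu ?Hw.
Qed.

(* ( I_rho  0    0       ...  0               )
   ( 0      I_h  alpha I_h ... alpha^(t-1) I_h ) *)
Definition sysG (rho h t : nat) (alpha : L) :
    'M[L]_(rho + h, rho + \sum_(j < t) h) :=
  block_mx 1%:M 0 0 (\mxrow_(j < t) ((alpha ^+ j)%:M : 'M[L]_h)).

End Systems.
Arguments is_s {F} L k rho s.
Arguments exists_rank_saturating {F} L k rho n.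

(* Main.v *)
Require Import Defs.
From Stdlib Require Classical_Prop.
From HB Require Import structures.
From mathcomp Require Import all_boot all_order all_algebra all_fingroup all_field.

Import GRing.Theory.
Local Open Scope ring_scope.

(** Write K = F[alpha], so that U = F^rho x K^h with rho = (r - 1) t + 1. A vector
    (x, y) of L^rho x L^h is a combination of rho vectors of U with coefficients
    lambda_1, ..., lambda_rho as soon as the F-span V of the lambda_l contains
    the entries of x and K V contains those of y. Extend the F-span of the
    entries of x to a V of F-dimension rho: then K V is a K-subspace of L of
    F-dimension greater than (r - 1) t, a multiple of t, hence K V = L. Fewer
    points do not suffice: if the entries of x are F-independent, then (x, 0) is
    not a combination of fewer than rho vectors of U. *)

(** Excluded middle decides whether a smaller witness exists: the predicate of interest, existence
    of a saturating system of length [n], is not boolean. *)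
Lemma exists_least (P : nat -> Prop) n :
  P n -> exists m, [/\ P m, (m <= n)%N & forall k, P k -> (m <= k)%N].
Proof.
elim/ltn_ind: n => n IHn Pn.
have [[k [ltkn Pk]]|noP] :=
  Classical_Prop.classic (exists k, (k < n)%N /\ P k).
  have [m [Pm lemk mmin]] := IHn k ltkn Pk.
  by exists m; split=> //; apply: leq_trans lemk (ltnW ltkn).
exists n; split=> // k Pk; rewrite leqNgt; apply/negP=> ltkn.
by apply: noP; exists k.
Qed.

(** * Extending free families, and products of subspaces *)

Lemma exists_free_tuple_sup (K : fieldType) (vT : vectType K)
    (V : {vspace vT}) n :
  (\dim V <= n <= \dim {:vT})%N ->
  exists X : n.-tuple vT, free X /\ (V <= <<X>>)%VS.
Proof.
(* [B] lists a basis of [V] before one of a complement, so its first [n] entries are free and, as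
   [n] is at least [\dim V], still span [V]. *)
case/andP=> leVn lenT; pose B := vbasis V ++ vbasis V^C.
have basB : basis_of fullv B.
  rewrite -(addv_complf V); apply: cat_basis; try exact: vbasisP.
  by rewrite directvE /= addv_complf dimv_compl subnKC ?dimvS ?subvf.
have szB : size B = \dim {:vT}.
  by rewrite (@size_basis _ _ _ _ (in_tuple B) basB).
have szX : size (take n B) == n.
  by rewrite size_take_min szB; apply/eqP/minn_idPl.
exists (Tuple szX); split.
  apply: (@catl_free _ _ (drop n B)).
  by rewrite /= cat_take_drop (basis_free basB).
rewrite -{1}(span_basis (vbasisP V)); apply: sub_span => x xV /=.
by rewrite take_cat size_tuple ltnNge leVn /= mem_cat xV.
Qed.

(** The product distributes over the lines of the entries [x] of [X], and [E * <[x]>] consists of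
    the multiples [b * x] with [b] in [E]. *)
Lemma prodv_spanP (F : fieldType) (L : fieldExtType F) (E : {vspace L}) n
    (X : n.-tuple L) (y : L) :
  y \in (E * <<X>>)%VS ->
  exists2 b : 'I_n -> L, (forall i, b i \in E) & y = \sum_i b i * X`_i.
Proof.
rewrite span_def big_tuple.
rewrite (big_morph (prodv E) (prodvDr E) (prodv0 E)) => /memv_sumP[z zE ->].
have /fin_all_exists[b bP] i : exists b, b \in E /\ z i = b * X`_i.
  have /memv_cosetP[b bE ->] := zE i isT.
  by exists b; rewrite (tnth_nth 0).
by exists b => [i|]; [case: (bP i) | apply: eq_bigr => i _; case: (bP i)].
Qed.

Lemma prodv_full (F : fieldType) (L : fieldExtType F) (E : {subfield L})
    (V : {vspace L}) r :
  \dim {:L} = (r * \dim E)%N -> ((r - 1) * \dim E < \dim V)%N ->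
  (E * V)%VS = fullv.
Proof.
move=> dimL ltV; apply/eqP; rewrite eqEdim subvf dimL /=.
(* Since [E * E = E], the product [E * V] is a vector space over the field [E]. *)
have /dvdnP[s dimEV] : (\dim E %| \dim (E * V))%N.
  by apply: field_module_dimS; rewrite prodvA prodv_id.
have : (\dim V <= \dim (E * V))%N.
  by apply: dimvS; rewrite -{1}[V]prod1v prodvSl // sub1v.
move=> /(leq_trans ltV); rewrite dimEV ltn_mul2r => /andP[_ lts].
by rewrite leq_mul2r (leq_trans _ lts) ?orbT // subn1 leqSpred.
Qed.

(** * Simple extensions of the ground field and their power basis *)

Lemma adjoin_degree_irreducible (F : fieldType) (L : fieldExtType F)
    (p : {poly F}) (x : L) :
  irreducible_poly p -> root (map_poly (in_alg L) p) x ->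
  adjoin_degree 1%AS x = (size p).-1.
Proof.
move=> [_ irrp] px0.
have /polyOver1P[m mE] := minPolyOver 1%AS x.
have szm : size m = (adjoin_degree 1%AS x).+1.
  by rewrite -(size_minPoly 1%AS x) mE size_map_poly.
(* The minimal polynomial divides [p] and is not constant, so irreducibility makes it associate to
   [p]. *)
have dvdmp : m %| p.
  rewrite -(dvdp_map (in_alg L)) -mE; apply: minPoly_dvdp => //.
  by apply/polyOver1P; exists p.
have /eqp_size <- : m %= p.
  by apply: irrp => //; rewrite szm.
by rewrite szm.
Qed.

Lemma dim_Fadjoin1 (F : fieldType) (L : fieldExtType F) (x : L) :
  \dim <<1; x>>%VS = adjoin_degree 1%AS x.
Proof. by rewrite (dim_Fadjoin 1%AS x) dimv1 muln1. Qed.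

Lemma powers_independent (F : fieldType) (L : fieldExtType F) (x : L)
    (c : 'I_(adjoin_degree 1%AS x) -> F) :
  \sum_i c i *: x ^+ i = 0 -> forall i, c i = 0.
Proof.
set n := adjoin_degree _ _ in c *.
(* The relation is a polynomial [q] with root [x] and size at most the degree [n] of the minimal
   polynomial, hence zero. The default 0 is never taken for [j < n]. *)
move=> sum0 i; pose q := \poly_(j < n) oapp c 0 (insub j).
have qE : map_poly (in_alg L) q = \poly_(j < n) (oapp c 0 (insub j))%:A.
  apply/polyP=> j; rewrite coef_map !coef_poly; case: ifP => // _.
  exact: rmorph0.
have : root (map_poly (in_alg L) q) x.
  rewrite qE /root horner_poly -[X in _ == X]sum0; apply/eqP/eq_bigr=> j _.
  by rewrite valK /= mulr_algl.
rewrite (@root_small_adjoin_poly _ _ 1%AS); first last.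
- by rewrite size_map_poly size_poly.
- by apply/polyOver1P; exists q.
rewrite map_poly_eq0 => /eqP q0.
have := congr1 (fun q : {poly F} => q`_i) q0.
by rewrite coef_poly ltn_ord valK coef0.
Qed.

Lemma mem_Fadjoin1P (F : fieldType) (L : fieldExtType F) (x v : L) :
  v \in <<1; x>>%VS ->
  exists c : 'I_(adjoin_degree 1%AS x) -> F, v = \sum_i c i *: x ^+ i.
Proof.
move=> /(@Fadjoin_poly_eq _ _ 1%AS) <-.
have /polyOver1P[q qE] := Fadjoin_polyOver 1%AS x v.
have := size_Fadjoin_poly 1%AS x v; rewrite qE => szq.
exists (fun i => q`_i); rewrite (horner_coef_wide _ szq).
by apply: eq_bigr => i _; rewrite coef_map /= mulr_algl.
Qed.

(** * Completing a family of subspaces to distinct ones *)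

Lemma exists_distinct_sup (K : fieldType) (vT : vectType K)
    (S : {vspace vT} -> Prop) n (e : 'I_n -> {vspace vT})
    (A : {vspace vT}) (V : 'I_n -> {vspace vT}) :
  injective e -> (forall i, S (e i)) ->
  (forall i, V i = 0%VS \/ S (V i)) -> (A <= \sum_i V i)%VS ->
  exists P : 'I_n -> {vspace vT},
    [/\ injective P, forall i, S (P i) & (A <= \sum_i P i)%VS].
Proof.
move=> einj eS VS AV.
(* The [V i] may vanish or repeat. Their distinct nonzero values [s] are padded with the [e i] not
   among them; [s] comes first and has at most [n] entries, so it survives truncation to length
   [n]. *)
pose s := undup [seq W <- codom V | W != 0%VS].
pose w := s ++ [seq W <- codom e | W \notin s].
have uw : uniq w.
  rewrite cat_uniq undup_uniq filter_uniq ?andbT /=; last exact/injectiveP.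
  by apply/hasPn=> W; rewrite mem_filter => /andP[].
have nw : (n <= size w)%N.
  rewrite -[n]card_ord -(size_codom e).
  apply: uniq_leq_size; first exact/injectiveP.
  by move=> W We; rewrite mem_cat mem_filter We andbT orbN.
have sn : (size s <= n)%N.
  rewrite -[n in (_ <= n)%N]card_ord -(size_codom V).
  by rewrite (leq_trans (size_undup _)) // size_filter count_size.
have wS W : W \in w -> S W.
  rewrite mem_cat mem_undup !mem_filter.
  case/orP=> /andP[W0 /codomP[i WE]]; last by rewrite WE.
  by rewrite WE; case: (VS i) => // Vi0; rewrite WE Vi0 eqxx in W0.
exists (fun i => nth 0%VS w i); split=> [i j /eqP|i|].
- rewrite nth_uniq // ?(leq_trans (ltn_ord _)) // => /eqP; exact: val_inj.
- by apply/wS/mem_nth/(leq_trans (ltn_ord i)).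
apply: subv_trans AV _; apply/subv_sumP=> i _.
have [->|Vi0] := eqVneq (V i) 0%VS; first exact: sub0v.
have Vis : V i \in s by rewrite mem_undup mem_filter Vi0 codom_f.
have idx : (index (V i) s < n)%N by rewrite (leq_trans _ sn) // index_mem.
apply: (sumv_sup (Ordinal idx)) => //=.
by rewrite nth_cat index_mem Vis nth_index.
Qed.

(** * The system, its span and its generator matrix *)

Section ConstructedSystem.
Variables (F : finFieldType) (L : fieldExtType F) (rho h : nat) (alpha : L).
Local Notation U := (sysU rho h alpha).
Local Notation t := (adjoin_degree 1%AS alpha).

Lemma colv0 k : colv (0 : {ffun 'I_k -> L}) = 0.
Proof. by apply/colP=> i; rewrite !mxE ffunE. Qed.

(** These vectors show that the system spans, and their lines are the distinct points used for
    padding. *)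
Definition unitv k (i : 'I_k) : {ffun 'I_k -> L} := [ffun j => (j == i)%:R].

Lemma unitv_neq0 k (i : 'I_k) : unitv k i != 0.
Proof.
by apply/eqP=> /ffunP/(_ i); rewrite !ffunE eqxx => /eqP; rewrite oner_eq0.
Qed.

Lemma unitv_sysU i : unitv (rho + h) i \in U.
Proof.
by apply/mem_sysU; split=> j; rewrite ffunE rpredMn ?mem1v.
Qed.

Lemma line_unitv_inj k : injective (fun i => <[colv (unitv k i)]>%VS).
Proof.
move=> i j eqij; apply/eqP; apply: contraT => neij.
have := memv_line (colv (unitv k i)); rewrite eqij => /vlineP[c].
move=> /colP/(_ i); rewrite !mxE !ffunE eqxx (negPf neij) mulr0 => /eqP.
by rewrite oner_eq0.
Qed.

Lemma sysU_spans (W : {vspace 'cV[L]_(rho + h)}) :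
  (forall u, u \in U -> colv u \in W) -> W = fullv.
Proof.
move=> UW; apply/vspaceP=> v; rewrite memvf.
have -> : v = \sum_i v i 0 *: colv (unitv (rho + h) i).
  apply/colP=> i; rewrite summxE (bigD1 i) //= !mxE ffunE eqxx mulr1.
  rewrite big1 ?addr0 // => j neji.
  by rewrite !mxE ffunE eq_sym (negPf neji) mulr0.
by apply: rpred_sum => i _; rewrite memvZ // UW // unitv_sysU.
Qed.

Let colG (j : 'I_(rho + \sum_(j < t) h)) : {ffun 'I_(rho + h) -> L} :=
  [ffun i => sysG rho h t alpha i j].

Lemma sum_colG_l (c : 'I_(rho + \sum_(j < t) h) -> F) i :
  (\sum_j c j *: colG j) (lshift h i) = (c (lshift _ i))%:A.
Proof.
rewrite sum_ffunE big_split_ord /= [X in _ + X]big1 ?addr0; last first.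
  by move=> j _; rewrite !ffunE block_mxEur mxE scaler0.
rewrite (bigD1 i) //= [X in _ + X]big1 ?addr0 => [|j neji];
  rewrite !ffunE block_mxEul mxE.
  by rewrite eqxx.
by rewrite eq_sym (negPf neji) scaler0.
Qed.

Lemma sum_colG_r (c : 'I_(rho + \sum_(j < t) h) -> F) l :
  (\sum_j c j *: colG j) (rshift rho l) =
  \sum_(a < t) c (rshift rho (tagnat.Rank a l)) *: alpha ^+ a.
Proof.
rewrite sum_ffunE big_split_ord /= [X in X + _]big1 ?add0r; last first.
  by move=> j _; rewrite !ffunE block_mxEdl mxE scaler0.
transitivity (\sum_(a < t) \sum_(b < h)
   c (rshift rho (tagnat.Rank (p_ := fun=> h) a b)) *: (alpha ^+ a *+ (l == b))).
  (* A column of the block row is a pair of a block [a] and a position [b] in it; [tagnat.sig] is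
     the bijection matching the two sums. *)
  rewrite sig_big_dep /= (reindex _ tagnat.sig_bij_on) /=.
  apply: eq_bigr => s _; rewrite !ffunE block_mxEdr !mxE.
  by congr (c (rshift rho _) *: _); rewrite [RHS]tagnat.sig2K.
apply: eq_bigr => a _.
rewrite (bigD1 l) //= eqxx [X in _ + X]big1 ?addr0 // => b nebl.
by rewrite eq_sym (negPf nebl) mulr0n scaler0.
Qed.

Lemma colG_sysU j : colG j \in U.
Proof.
apply/mem_sysU; split=> i; rewrite ffunE; case: (split_ordP j) => k ->.
- by rewrite block_mxEul mxE rpredMn ?mem1v.
- by rewrite block_mxEur mxE mem0v.
- by rewrite block_mxEdl mxE mem0v.
rewrite block_mxEdr !mxE rpredMn // (rpredX (S := <<1; alpha>>%AS)) //.
exact: (memv_adjoin 1%AS alpha).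
Qed.

Lemma sysU_generator_matrix : generator_matrix U (sysG rho h t alpha).
Proof.
pose X := [tuple of map colG (ord_tuple (rho + \sum_(j < t) h))].
have XE (j : 'I_(rho + \sum_(j < t) h)) : X`_j = colG j.
  by rewrite -tnth_nth tnth_map tnth_ord_tuple.
suff: basis_of U X by rewrite /generator_matrix -val_ord_tuple.
apply/andP; split; last first.
  (* The upper rows return the first [rho] coefficients themselves; each lower row is an
     [F]-relation between powers of [alpha]. *)
  apply/freeP=> c; under eq_bigr do rewrite XE.
  move=> /ffunP c0 j; case: (split_ordP j) => k ->.
    have := c0 (lshift h k); rewrite sum_colG_l ffunE => /eqP.
    by rewrite scaler_eq0 oner_eq0 orbF => /eqP.
  have := c0 (rshift rho (tagnat.sig2 k)); rewrite sum_colG_r ffunE.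
  by move=> /powers_independent/(_ (tagnat.sig1 k)); rewrite tagnat.sig2K.
rewrite eqEsubv; apply/andP; split.
  by apply/span_subvP=> _ /mapP[j _ ->]; apply: colG_sysU.
apply/subvP=> v /mem_sysU[v1 v2].
have /fin_all_exists[a aE] i : exists a : F, v (lshift h i) = a%:A.
  by have /vlineP := v1 i.
have /fin_all_exists[b bE] l := mem_Fadjoin1P _ _ _ _ (v2 l).
(* Upper entries of [v] are their own coefficients; lower ones contribute their coordinates in the
   power basis. *)
pose c j := match split j with
  | inl i => a i | inr k => b (tagnat.sig2 k) (tagnat.sig1 k) end.
have -> : v = \sum_j c j *: colG j.
  apply/ffunP=> k; case: (split_ordP k) => i ->.
    by rewrite sum_colG_l /c (unsplitK (inl i)) aE.
  rewrite sum_colG_r bE; apply: eq_bigr => d _; rewrite /c (unsplitK (inr _)).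
  congr (b _ _ *: _); last by rewrite tagnat.Rank1K.
  by apply: val_inj; rewrite tagnat.Rank2K.
apply: rpred_sum => j _.
by rewrite memvZ // memv_span // map_f // val_ord_tuple mem_enum.
Qed.

Lemma dim_sysU : \dim U = (rho + t * h)%N.
Proof.
have := sysU_generator_matrix; rewrite /generator_matrix -val_ord_tuple.
move=> /(@size_basis _ _ _ _ (map_tuple _ _)) ->.
by rewrite sum_nat_const card_ord.
Qed.

(** * Saturation by [rho] points, and by no fewer *)

Lemma sysU_spanned_by r :
  \dim {:L} = (r * t)%N -> ((r - 1) * t < rho)%N -> (rho <= \dim {:L})%N ->
  spanned_by (linear_set U) rho.
Proof.
move=> dimL ltrho lerho Q Q1.
pose v := vpick Q.
have QE : Q = <[v]>%VS.
  apply/esym/eqP; rewrite eqEdim -memvE memv_pick dim_vline vpick0 Q1.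
  by rewrite -dimv_eq0 Q1.
(* The [lam] are the multipliers: free over [F], with the upper entries of [v] in their span. *)
have [|lam [lamfree xlam]] := @exists_free_tuple_sup _ _
    <<[tuple v (lshift h i) (0 : 'I_1)%R | i < rho]>>%VS rho.
  by rewrite lerho andbT (leq_trans (dim_span _)) ?size_tuple.
have Elam : (<<1; alpha>> * <<lam>>)%VS = fullv.
  apply: (prodv_full _ _ <<1; alpha>>%AS _ r); rewrite /= dim_Fadjoin1 //.
  by move/eqP: lamfree => ->; rewrite size_tuple.
have aE i : v (lshift h i) 0 = \sum_l coord lam l (v (lshift h i) 0) *: lam`_l.
  apply/coord_span/(subvP xlam)/memv_span/mapP.
  by exists i; rewrite ?mem_enum.
have /fin_all_exists[b bP] j : exists b : 'I_rho -> L,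
    (forall l, b l \in <<1; alpha>>%VS) /\
    v (rshift rho j) 0 = \sum_l b l * lam`_l.
  have [|b bE vE] := prodv_spanP _ _ <<1; alpha>>%VS _ lam (v (rshift rho j) 0).
    by rewrite Elam memvf.
  by exists b.
(* [u l] collects the coefficients of the [l]-th multiplier, in [F] above and in [F[alpha]] below,
   so that [v] is the combination of the [u l] with coefficients [lam]. *)
pose u l : {ffun 'I_(rho + h) -> L} := [ffun k => match split k with
  | inl i => (coord lam l (v (lshift h i) 0))%:A | inr j => b j l end].
have uU l : u l \in U.
  apply/mem_sysU; split=> i; rewrite ffunE.
    by rewrite (unsplitK (inl i)) rpredZ ?mem1v.
  by rewrite (unsplitK (inr i)); case: (bP i).
(* Some [u l] may vanish or be proportional, whereas [spanned_by] demands distinct points. *)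
apply: (@exists_distinct_sup _ _ _ _
  (fun i => <[colv (unitv _ (lshift h i))]>%VS) _ (fun l => <[colv (u l)]>%VS)).
- by move=> i j /line_unitv_inj/lshift_inj.
- by move=> i; exists (unitv _ (lshift h i)); rewrite unitv_sysU unitv_neq0.
- move=> l; have [->|u0] := eqVneq (u l) 0; first by left; rewrite colv0.
  by right; exists (u l).
rewrite QE -memvE.
have -> : v = \sum_(l < rho) lam`_l *: colv (u l).
  apply/colP=> k; rewrite summxE; case: (split_ordP k) => i ->.
    rewrite [LHS]aE; apply: eq_bigr => l _.
    by rewrite !mxE ffunE (unsplitK (inl i)) mulr_algr.
  case: (bP i) => _ ->; apply: eq_bigr => l _.
  by rewrite !mxE ffunE (unsplitK (inr i)) mulrC.
by apply: rpred_sum => l _; rewrite memvZ // memvE (sumv_sup l).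
Qed.

Lemma leq_sysU_spanned_by m :
  (0 < rho <= \dim {:L})%N -> spanned_by (linear_set U) m -> (rho <= m)%N.
Proof.
case/andP=> rho_gt0 lerho spU.
have [|x [xfree _]] := @exists_free_tuple_sup _ L 0%VS rho.
  by rewrite dimv0 lerho.
(* The point hardest to reach: upper entries independent over [F], lower ones zero. *)
pose v : 'cV[L]_(rho + h) := \col_k match split k with
  | inl i => x`_i | inr _ => 0 end.
have vE i : v (lshift h i) 0 = x`_i by rewrite mxE (unsplitK (inl i)).
have v0 : v != 0.
  apply/eqP=> /colP/(_ (lshift h (Ordinal rho_gt0))); rewrite vE mxE /= => x0.
  have : x`_0 \in (x : seq L) by rewrite mem_nth ?size_tuple.
  by move=> /(free_not0 xfree); rewrite x0 eqxx.
have [|P [_ PU]] := spU <[v]>%VS; first by rewrite /is_point dim_vline v0.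
rewrite -memvE => /memv_sumP[w wP wE].
have /fin_all_exists[u uP] i : exists u, u \in U /\ P i = <[colv u]>%VS.
  by have [u [uU _ PE]] := PU i; exists u.
have /fin_all_exists[c cE] i : exists c, w i = c *: colv (u i).
  by apply/vlineP; case: (uP i) => _ <-; apply: wP.
(* The upper entries of each [u i] lie in [F], so those of [v] are [F]-combinations of the [m]
   coefficients [c i]; comparing dimensions bounds [rho] by [m]. *)
have : (<<x>> <= <<[tuple c i | i < m]>>)%VS.
  apply/span_subvP=> y /(nthP 0)[n ltn <-]; rewrite size_tuple in ltn.
  rewrite -(vE (Ordinal ltn)) wE summxE; apply: rpred_sum => i _.
  rewrite cE !mxE; have /mem_sysU[/(_ (Ordinal ltn))/vlineP[a ->] _] := (uP i).1.
  rewrite mulr_algr memvZ // memv_span //; apply/mapP.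
  by exists i; rewrite ?mem_enum.
move/dimvS; move/eqP: xfree => ->; rewrite size_tuple => /leq_trans-> //.
by rewrite (leq_trans (dim_span _)) ?size_tuple.
Qed.

End ConstructedSystem.

Theorem theorem4p14 (F : finFieldType) (L : fieldExtType F) (r t h : nat)
    (p : {poly F}) (alpha : L)
    (hr : (2 <= r)%N) (ht : (2 <= t)%N)
    (hL : \dim {:L} = (r * t)%N)
    (hp : irreducible_poly p) (hpt : size p = t.+1)
    (halpha : root (map_poly (in_alg L) p) alpha) :
  let rho := ((r - 1) * t + 1)%N in
  let U := sysU rho h alpha in
  [/\ is_system (t * h + (r - 1) * t + 1) U,
      generator_matrix U (sysG rho h t alpha),
      rank_saturating U rho
    & exists s, is_s L (h + (r - 1) * t + 1) rho s /\
                (s <= t * h + (r - 1) * t + 1)%N].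
Proof.
move=> rho U.
have tE : adjoin_degree 1%AS alpha = t.
  by rewrite (adjoin_degree_irreducible _ _ p) // hpt.
have rho_gt0 : (0 < rho)%N by rewrite /rho addn1.
have lerho : (rho <= \dim {:L})%N.
  rewrite hL /rho mulnBl mul1n -[X in (_ <= X)%N](@subnK t) ?leq_add2l //.
    exact: ltnW.
  by rewrite leq_pmull // ltnW.
have sysUP : is_system (t * h + (r - 1) * t + 1) U.
  split; last exact: sysU_spans.
  by rewrite dim_sysU tE addnC addnA.
have satU : rank_saturating U rho.
  (* Saturation index [rho.-1] means spanning by [rho] points, which needs [rho] positive. *)
  split=> //; split=> [|m]; rewrite ?prednK //.
    by apply: (@sysU_spanned_by _ _ _ _ _ r); rewrite ?tE // /rho addn1.
  rewrite -ltnS prednK //; apply: leq_sysU_spanned_by.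
  by rewrite rho_gt0.
split=> //; first by rewrite -tE; apply: sysU_generator_matrix.
have [s [sP les smin]] : exists s, [/\ exists_rank_saturating L (rho + h) rho s,
    (s <= t * h + (r - 1) * t + 1)%N
    & forall k, exists_rank_saturating L (rho + h) rho k -> (s <= k)%N].
  by apply: exists_least; exists U.
by exists s; rewrite -addnA [(h + _)%N]addnC; split.
Qed.
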